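(* Let $S\neq\mathbb{N}$ be a numerical semigroup. Then $$t(S)=\frac{g(S)}{F(S)+1-g(S)}$$ if and only if either $S$ is symmetric or there exist positive integers $m,n$ such that $$S=\{0,m,2m,\dots,(n-1)m\}\cup\{x\in\mathbb{N}\mid x\geq nm\}.$$
   Context: $\mathbb{N}=\{0,1,2,\dots\}$. A numerical semigroup is a subset $S\subseteq\mathbb{N}$ containing $0$, closed under addition, with finite complement in $\mathbb{N}$. The elements of $\mathbb{N}\setminus S$ are the gaps of $S$; the genus $g(S)$ is the number of gaps; for $S\neq\mathbb{N}$ the Frobenius number $F(S)$ is the largest gap. The set of pseudo-Frobenius numbers is $PF(S)=\{x\in\mathbb{N}\setminus S \mid x+s\in S \text{ for all } s\in S\setminus\{0\}\}$, and the type is $t(S)=|PF(S)|$. $S$ is symmetric if for every integer $x$, exactly one of $x$ and $F(S)-x$ belongs to $S$ (equivalently $2g(S)=F(S)+1$). *)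

(* Defs.v *)
From mathcomp Require Import all_boot all_order all_algebra finmap.
From mathcomp Require Import boolp classical_sets functions cardinality.

Set Implicit Arguments.
Unset Strict Implicit.
Unset Printing Implicit Defensive.

Import Order.TTheory GRing.Theory Num.Theory.

Local Open Scope classical_set_scope.

Definition numerical_semigroup (S : set nat) : Prop :=
  [/\ S 0%N,
      forall x y, S x -> S y -> S (x + y)%N
    & finite_set (~` S)].

Definition gaps (S : set nat) : set nat := ~` S.

(* [fset_set A] is the finite set of elements of [A] when [A] is finite, and
   the empty set otherwise. *)
Definition genus (S : set nat) : nat := #|` fset_set (gaps S)|%fset.

(* The largest gap; takes the default value 0 when there are no gaps. *)
Definition frobenius (S : set nat) : nat := \max_(x <- fset_set (gaps S)) x.

Definition pseudo_frobenius (S : set nat) : set nat :=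
  [set x | ~ S x /\ forall s, S s -> s <> 0%N -> S (x + s)%N].

Definition sg_type (S : set nat) : nat :=
  #|` fset_set (pseudo_frobenius S)|%fset.

(* [x] ranges over all integers, so [S] is viewed as a subset of [int]; in
   particular negative integers are never members. *)
Definition symmetric_sg (S : set nat) : Prop :=
  let SZ : set int := Posz @` S in
  forall x : int,
    let y : int := ((frobenius S)%:Z - x)%R in
    (SZ x /\ ~ SZ y) \/ (~ SZ x /\ SZ y).

(* Main.v *)
(** Let n = F + 1 - g be the number of elements of S below F.  Every gap is
    f - s with f pseudo-Frobenius and s in S below F, so g <= t n, and equality
    holds exactly when all t n differences f - s are distinct gaps.  In the
    equality case every pseudo-Frobenius number exceeds the largest element q
    of S below F.  With m the multiplicity, q + m > F, so every gap above q is
    pseudo-Frobenius: PF(S) = {q+1, .., F} and t = F - q < m.  Every x with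
    F - m < x <= q lies in S: x = f - s would force s < m, hence s = 0 and
    f = x <= q.  If t >= 2, distinctness of the differences forbids two
    consecutive elements of S below F, so m = t + 1.  Then F + 1 = n m, and the
    n multiples of m below F exhaust S there. *)

Require Import Defs.
From mathcomp Require Import all_boot all_order all_algebra finmap zify.
From mathcomp Require Import boolp classical_sets functions cardinality.

Set Implicit Arguments.
Unset Strict Implicit.

Import Order.TTheory GRing.Theory Num.Theory.

Local Open Scope classical_set_scope.

(** * Lists without repetition and finite cardinals *)

Lemma map_uniq_inj (T U : eqType) (f : T -> U) (s : seq T) :
  uniq (map f s) -> {in s &, injective f}.
Proof.
elim: s => [|a s IHs] //= /andP[fa_s /IHs inj] x y.
rewrite !inE => /predU1P[->|xs] /predU1P[->|ys] // fxy; last exact: inj.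
- by rewrite fxy map_f in fa_s.
- by rewrite -fxy map_f in fa_s.
Qed.

Lemma card_fset_set_seq {T : choiceType} (A : set T) (s : seq T) :
  uniq s -> (forall x, A x <-> x \in s) -> #|` fset_set A|%fset = size s.
Proof.
move=> s_uniq As.
have -> : A = [set` s] by apply/seteqP; split=> x /= /As.
apply/perm_size/uniq_perm => // x.
by rewrite in_fset_set ?mem_setE //; apply: finite_seq.
Qed.

(** * The Frobenius number as the largest gap *)

Lemma gap_le_frobenius S x : numerical_semigroup S -> ~ S x ->
  x <= frobenius S.
Proof.
case=> _ _ fin nSx; rewrite /frobenius.
by apply: leq_bigmax_seq => //; rewrite in_fset_set // inE.
Qed.

Lemma bigmax_mem (s : seq nat) : s != [::] -> \max_(x <- s) x \in s.
Proof.
elim: s => // a [|b s] IHs _; first by rewrite big_seq1 mem_head.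
rewrite big_cons inE; set M := \max_(_ <- _) _ in IHs *.
by case: (leqP a M) => _; rewrite ?eqxx ?IHs ?orbT.
Qed.

Lemma frobenius_gap S : numerical_semigroup S -> S <> [set: nat] ->
  ~ S (frobenius S).
Proof.
case=> _ _ fin /eqP /setTPn[x nSx].
have : frobenius S \in fset_set (gaps S); last by rewrite in_fset_set // inE.
have x_in : x \in enum_fset (fset_set (gaps S)).
  by rewrite [_ \in _]in_fset_set // inE.
by apply: bigmax_mem; case: enum_fset x_in.
Qed.

(** * Enumerations of gaps, sporadic elements and pseudo-Frobenius numbers *)

Definition gap_seq (S : set nat) : seq nat :=
  [seq x <- iota 0 (frobenius S).+1 | ~~ `[< S x >]].

(** Its size is the denominator F + 1 - g of the theorem. *)
Definition sporadic_seq (S : set nat) : seq nat :=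
  [seq x <- iota 0 (frobenius S).+1 | `[< S x >]].

Definition pf_seq (S : set nat) : seq nat :=
  [seq x <- iota 0 (frobenius S).+1 | `[< pseudo_frobenius S x >]].

Lemma mem_gap_seq S x : numerical_semigroup S ->
  (x \in gap_seq S) <-> ~ S x.
Proof.
move=> hS; rewrite mem_filter mem_iota /= add0n ltnS; split.
  by case/andP => /asboolP.
by move=> nSx; rewrite gap_le_frobenius // andbT; apply/asboolP.
Qed.

Lemma mem_sporadic_seq S x :
  (x \in sporadic_seq S) <-> S x /\ x <= frobenius S.
Proof.
rewrite mem_filter mem_iota /= add0n ltnS; split.
  by case/andP => /asboolP.
by case=> Sx ->; rewrite andbT; apply/asboolP.
Qed.

Lemma mem_pf_seq S x : numerical_semigroup S ->
  (x \in pf_seq S) <-> pseudo_frobenius S x.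
Proof.
move=> hS; rewrite mem_filter mem_iota /= add0n ltnS; split.
  by case/andP => /asboolP.
move=> PFx; rewrite gap_le_frobenius ?andbT; [exact/asboolP|by []|].
by case: PFx.
Qed.

Lemma genusE S : numerical_semigroup S -> genus S = size (gap_seq S).
Proof.
move=> hS; apply: card_fset_set_seq; first exact/filter_uniq/iota_uniq.
by move=> x; rewrite mem_gap_seq.
Qed.

Lemma sg_typeE S : numerical_semigroup S -> sg_type S = size (pf_seq S).
Proof.
move=> hS; apply: card_fset_set_seq; first exact/filter_uniq/iota_uniq.
by move=> x; rewrite mem_pf_seq.
Qed.

Lemma size_sporadic_genus S : numerical_semigroup S ->
  size (sporadic_seq S) + genus S = (frobenius S).+1.
Proof.
move=> hS; rewrite genusE // !size_filter -[RHS](size_iota 0).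
exact: count_predC.
Qed.

(** * Gaps as differences f - s *)

(** Induction on F - x: a gap that is not pseudo-Frobenius remains a gap after adding some nonzero
    element of S, and gaps never exceed F. *)
Lemma gap_pf_sub S x : numerical_semigroup S -> ~ S x ->
  exists s, S s /\ pseudo_frobenius S (x + s).
Proof.
move=> hS; have [k] := ubnP (frobenius S - x); elim: k x => // k IHk x lek nSx.
have [PFx|] := pselect (pseudo_frobenius S x).
  by exists 0; rewrite addn0; split=> //; case: hS.
move=> /not_andP[//|/existsNP[s /not_implyP[Ss /not_implyP[s0 nSxs]]]].
have xsF := gap_le_frobenius hS nSxs.
have [|u [Su PFu]] := IHk (x + s) _ nSxs; first by lia.
exists (s + u); rewrite addnA; split=> //.
by case: hS => _ add _; apply: add.
Qed.

Lemma gap_diff S x : numerical_semigroup S -> ~ S x ->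
  exists f s, [/\ f \in pf_seq S, s \in sporadic_seq S & x = f - s].
Proof.
move=> hS nSx; have [s [Ss PFxs]] := gap_pf_sub hS nSx.
have xsF := gap_le_frobenius hS PFxs.1.
exists (x + s), s; rewrite addnK; split=> //; first exact/mem_pf_seq.
by apply/mem_sporadic_seq; split=> //; lia.
Qed.

(* Truncation in [p.1 - p.2] is harmless: a truncated difference is 0, which
   is not a gap. *)
Lemma pf_sporadic_diff S : numerical_semigroup S ->
  sg_type S * size (sporadic_seq S) = genus S ->
  let L := [seq (f, s) | f <- pf_seq S, s <- sporadic_seq S] in
  (forall p, p \in L -> ~ S (p.1 - p.2)) /\
  {in L &, injective (fun p => p.1 - p.2)}.
Proof.
move=> hS; rewrite sg_typeE // genusE // => E L.
pose d (p : nat * nat) := p.1 - p.2.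
have sub : {subset gap_seq S <= map d L}.
  move=> x /(mem_gap_seq _ hS) nSx; have [f [s [fP sN ->]]] := gap_diff hS nSx.
  by apply/mapP; exists (f, s) => //; apply: allpairs_f.
have gu : uniq (gap_seq S) by exact/filter_uniq/iota_uniq.
have le : size (map d L) <= size (gap_seq S) by rewrite size_map size_allpairs E.
(* At most g differences cover g distinct gaps, so none is repeated and none falls outside the
   gaps. *)
split; last exact: map_uniq_inj (leq_size_uniq gu sub le).
move=> p pL; apply/(mem_gap_seq _ hS).
by rewrite (uniq_min_size gu sub le).2; apply/mapP; exists p.
Qed.

(** * Symmetric semigroups *)

(** Outside [0, F], one of x and F - x is negative and the other exceeds F. Inside, both cannot lie
    in S, since their sum F is a gap. *)
Lemma symmetric_sgP S : numerical_semigroup S -> S <> [set: nat] ->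
  symmetric_sg S <-> (forall x y, x + y = frobenius S -> ~ S x -> S y).
Proof.
move=> hS hSN; have nSF := frobenius_gap hS hSN; have [_ add _] := hS.
have nat_mem (x : nat) : (Posz @` S) (Posz x) <-> S x.
  by split=> [[u Su [<-]]|Sx] //; exists x.
have neg (x : int) : (x < 0)%R -> ~ (Posz @` S) x by move=> x0 [u _ E]; lia.
have big (x : int) : ((frobenius S)%:Z < x)%R -> (Posz @` S) x.
  move=> Fx; have -> : x = `|x|%N by lia.
  apply: (nat_mem _).2; apply: contrapT => nS; have := gap_le_frobenius hS nS; lia.
split=> [sym x y xyF nSx|sym SZ x y]; last rewrite {}/SZ {}/y.
  have := sym (Posz x); cbv zeta; rewrite -xyF PoszD [(Posz x + _)%R]addrC addrK.
  by rewrite !nat_mem => -[[]|[]].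
have [x0|x0] := ltP x 0%R.
  by right; split; [exact: neg | apply: big; lia].
have [Fx|Fx] := ltP (frobenius S)%:Z%R x.
  by left; split; [exact: big | apply: neg; lia].
have -> : ((frobenius S)%:Z - x)%R = (frobenius S - `|x|)%N by lia.
have -> : x = `|x|%N by lia.
rewrite !nat_mem absz_nat.
have E : `|x|%N + (frobenius S - `|x|)%N = frobenius S by lia.
have [Sx|nSx] := pselect (S `|x|%N); last by right; split=> //; apply: sym E nSx.
by left; split=> // Sy; apply: nSF; rewrite -E; apply: add.
Qed.

Lemma frobenius_pf S : numerical_semigroup S -> S <> [set: nat] ->
  pseudo_frobenius S (frobenius S).
Proof.
move=> hS hSN; split=> [|s Ss s0]; first exact: frobenius_gap.
by apply: contrapT => /(gap_le_frobenius hS); lia.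
Qed.

(** F is then the only pseudo-Frobenius number, so [gap_pf_sub] completes every gap to F by an
    element of S. *)
Lemma symmetric_of_type1 S : numerical_semigroup S -> S <> [set: nat] ->
  sg_type S = 1 -> symmetric_sg S.
Proof.
move=> hS hSN; rewrite sg_typeE // symmetric_sgP // => t1 x y xyF nSx.
have PF f : pseudo_frobenius S f -> f = frobenius S.
  have /(mem_pf_seq _ hS) := frobenius_pf hS hSN.
  rewrite -(mem_pf_seq _ hS).
  by case: (pf_seq S) t1 => [|a [|]] //= _; rewrite !inE => /eqP -> /eqP.
have [s [Ss /PF xsF]] := gap_pf_sub hS nSx.
by have -> : y = s by lia.
Qed.

(** The type is 1: a pseudo-Frobenius x < F would have F - x in S, hence F in S. The reflection s ->
    F - s then matches sporadic elements with gaps. *)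
Lemma type_genus_of_symmetric S : numerical_semigroup S -> S <> [set: nat] ->
  symmetric_sg S -> sg_type S * size (sporadic_seq S) = genus S.
Proof.
move=> hS hSN /(symmetric_sgP hS hSN) sym; have [_ add _] := hS.
have nSF := frobenius_gap hS hSN.
have -> : sg_type S = 1.
  apply: (@card_fset_set_seq _ _ [:: frobenius S]) => // x; rewrite inE.
  split=> [PFx|/eqP ->]; last exact: frobenius_pf.
  have xF := gap_le_frobenius hS PFx.1.
  apply/eqP; apply: contrapT => neF; apply: nSF.
  have E : x + (frobenius S - x) = frobenius S by lia.
  by rewrite -E; apply: PFx.2; [apply: sym E PFx.1 | lia].
rewrite mul1n genusE // -(size_map (subn (frobenius S))).
apply/perm_size/uniq_perm => [||x]; last 2 first.
- exact/filter_uniq/iota_uniq.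
- apply/mapP/idP => [[s /mem_sporadic_seq[Ss sF] ->]|].
    apply/(mem_gap_seq _ hS) => SFs; apply: nSF.
    by rewrite -(subnKC sF); apply: add.
  move=> /(mem_gap_seq _ hS) nSx; have xF := gap_le_frobenius hS nSx.
  exists (frobenius S - x); last by rewrite subKn.
  by apply/mem_sporadic_seq; split; [apply: (sym x) => //; lia | lia].
- rewrite map_inj_in_uniq; first exact/filter_uniq/iota_uniq.
  by move=> x y /mem_sporadic_seq[_ ?] /mem_sporadic_seq[_ ?]; lia.
Qed.

(** * Initial multiples of m followed by a half-line *)

Definition multiples_sg (m n : nat) : set nat :=
  [set (k * m)%N | k in [set k : nat | (k < n)%N]]
    `|` [set x : nat | (n * m <= x)%N].

Lemma multiples_sgP m n x :
  multiples_sg m n x <-> (m %| x) || (n * m <= x).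
Proof.
split=> [[[k _ <-]|/= ->]|]; rewrite ?orbT ?dvdn_mull //.
have [le _|gt] := leqP (n * m) x; first by right.
rewrite orbF => /dvdnP[k xE]; left; exists k => //=.
by rewrite xE ltn_mul2r in gt; case/andP: gt.
Qed.

Lemma mkseq_muln_sporadic S m n : 0 < m -> (frobenius S).+1 = n * m ->
  (forall k, k < n -> S (k * m)) ->
  uniq (mkseq (muln^~ m) n) /\ {subset mkseq (muln^~ m) n <= sporadic_seq S}.
Proof.
move=> m0 Fnm SM; split.
  by rewrite mkseq_uniq // => x y /eqP; rewrite eqn_pmul2r // => /eqP.
move=> x /mapP[k]; rewrite mem_iota /= => kn ->.
apply/mem_sporadic_seq; split; first exact: SM.
by rewrite -ltnS Fnm ltn_pmul2r.
Qed.

(** Here F = nm - 1, the sporadic elements are the n multiples of m below nm, and the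
    pseudo-Frobenius numbers are the m - 1 integers strictly between (n-1)m and nm. Hence g = nm - n
    = (m-1)n. *)
Lemma type_genus_of_multiples m n (S := multiples_sg m n) :
  numerical_semigroup S -> S <> [set: nat] -> 0 < m -> 0 < n ->
  sg_type S * size (sporadic_seq S) = genus S.
Proof.
move=> hS hSN m0 n0.
have m1 : 1 < m.
  rewrite ltn_neqAle m0 andbT; apply/eqP => m1; apply: hSN.
  by apply/seteqP; split=> // x _; apply/multiples_sgP; rewrite -m1 dvd1n.
have mnm : m <= n * m by rewrite leq_pmull.
have Fnm : (frobenius S).+1 = n * m.
  apply/eqP; rewrite eqn_leq; apply/andP; split.
    rewrite ltnNge; apply/negP => le; apply: (frobenius_gap hS hSN).
    by apply/multiples_sgP; rewrite le orbT.
  rewrite -(prednK (leq_trans m0 mnm)) ltnS; apply: (gap_le_frobenius hS).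
  move/multiples_sgP; rewrite leqNgt prednK ?leqnn ?orbF; last by lia.
  (* If m divided nm - 1, it would divide 1. *)
  move=> dv; have : m %| n * m - (n * m).-1 by rewrite dvdn_sub // dvdn_mull.
  by rewrite (_ : _ - _ = 1); [rewrite dvdn1; lia | lia].
have [u sub] : uniq (mkseq (muln^~ m) n) /\
    {subset mkseq (muln^~ m) n <= sporadic_seq S}.
  apply: mkseq_muln_sporadic => // k _.
  by apply/multiples_sgP; rewrite dvdn_mull.
have size_n : size (sporadic_seq S) = n.
  rewrite -(size_mkseq (muln^~ m) n); apply/perm_size/uniq_perm => //.
    exact/filter_uniq/iota_uniq.
  move=> x; apply/idP/idP => [|/sub //]; case/mem_sporadic_seq.
  move=> /multiples_sgP dv; rewrite -ltnS Fnm => xlt; move: dv.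
  rewrite leqNgt xlt orbF => /dvdnP[k xE]; apply/mapP; exists k => //.
  by rewrite mem_iota /= add0n; rewrite xE ltn_pmul2r in xlt.
have type_m : sg_type S = m.-1.
  rewrite -(size_iota (n.-1 * m).+1 m.-1).
  apply: card_fset_set_seq => [|x]; first exact: iota_uniq.
  have nmE : n.-1 * m + m = n * m by rewrite -mulSnr prednK.
  rewrite mem_iota; split=> [[nSx PFx]|/andP[lo hi]].
    have xlt : x < n * m.
      rewrite ltnNge; apply/negP => le; apply: nSx.
      by apply/multiples_sgP; rewrite le orbT.
    have ndv : ~~ (m %| x).
      by apply/negP => dv; apply: nSx; apply/multiples_sgP; rewrite dv.
    have Sm : S m by apply/multiples_sgP; rewrite dvdnn.
    (* x + m is not a multiple of m, so it must reach the half-line, giving x >= (n-1)m. *)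
    have /multiples_sgP := PFx m Sm ltac:(lia).
    rewrite dvdn_addl // (negPf ndv) /= => le.
    have ne : x != n.-1 * m by apply: contra ndv => /eqP ->; rewrite dvdn_mull.
    by lia.
  split=> [/multiples_sgP/orP[/dvdnP[k xE]|]|s Ss s0]; last 2 first.
  - by lia.
  - apply/multiples_sgP/orP; right.
    by case/multiples_sgP/orP: Ss => [/dvdn_leq|]; lia.
  have k1 : n.-1 < k by rewrite -(ltn_pmul2r m0) -xE.
  have k2 : k < n by rewrite -(ltn_pmul2r m0) -xE; lia.
  by lia.
have := size_sporadic_genus hS; rewrite size_n type_m Fnm => E.
by rewrite -(prednK m0) in E *; nia.
Qed.

(** * The equality case with type different from 1 *)

Lemma multiples_of_type_genus S : numerical_semigroup S -> S <> [set: nat] ->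
  sg_type S * size (sporadic_seq S) = genus S -> sg_type S <> 1 ->
  exists m n, [/\ 0 < m, 0 < n & S = multiples_sg m n].
Proof.
move=> hS hSN E t1; have [S0 add _] := hS.
have [diff inj] := pf_sporadic_diff hS E.
have nSF := frobenius_gap hS hSN.
set F := frobenius S in nSF *.
have big x : F < x -> S x.
  by move=> Fx; apply: contrapT => /(gap_le_frobenius hS); rewrite -/F; lia.
have inL f s : pseudo_frobenius S f -> S s -> s <= F ->
    (f, s) \in [seq (f, s) | f <- pf_seq S, s <- sporadic_seq S].
  move=> PFf Ss sF.
  by apply: allpairs_f; [apply/mem_pf_seq | apply/mem_sporadic_seq].
have diffN f s : pseudo_frobenius S f -> S s -> s <= F -> ~ S (f - s).
  by move=> PFf Ss sF; apply: (diff (f, s)); apply: inL.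
have diffI f s f' s' : pseudo_frobenius S f -> pseudo_frobenius S f' ->
    S s -> S s' -> s <= F -> s' <= F -> f - s = f' - s' -> s = s'.
  move=> PFf PFf' Ss Ss' sF s'F e.
  by have [] := inj _ _ (inL f s PFf Ss sF) (inL f' s' PFf' Ss' s'F) e.
have exm : exists m, (0 < m) && `[< S m >].
  by exists F.+1; rewrite /=; apply/asboolP/big.
have [m /andP[m0 /asboolP Sm] mmin] := ex_minnP exm.
have {}mmin x : S x -> 0 < x -> m <= x.
  by move=> Sx x0; apply: mmin; rewrite x0; apply/asboolP.
have exq : exists q, (q <= F) && `[< S q >] by exists 0; apply/asboolP.
have [q /andP[qF /asboolP Sq] qmax] :=
  @ex_maxnP _ F exq ltac:(by move=> ? /andP[]).
have {}qmax x : S x -> x <= F -> x <= q.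
  by move=> Sx xF; apply: qmax; rewrite xF; apply/asboolP.
have qmF : F < q + m.
  by rewrite ltnNge; apply/negP => /(qmax _ (add _ _ Sq Sm)); lia.
have PFE x : pseudo_frobenius S x <-> q < x <= F.
  split=> [PFx|/andP[qx xF]].
    rewrite (gap_le_frobenius hS PFx.1) andbT ltnNge; apply/negP => xq.
    (* For x <= q the truncated difference x - q is 0, which lies in S. *)
    by apply: (diffN x q PFx Sq qF); rewrite (_ : x - q = 0) //; lia.
  split=> [Sx|s Ss s0]; first by have := qmax x Sx xF; lia.
  by apply: big; have := mmin s Ss ltac:(lia); lia.
have neqF : q <> F by move=> qE; rewrite qE in Sq.
have typeE : sg_type S = F - q.
  rewrite -(size_iota q.+1 (F - q)).
  apply: card_fset_set_seq => [|x]; first exact: iota_uniq.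
  by rewrite mem_iota PFE; lia.
have FPF := frobenius_pf hS hSN.
have tail x : F < x + m -> x <= q -> S x.
  move=> Fxm xq; apply: contrapT => nSx.
  have [s [Ss PFxs]] := gap_pf_sub hS nSx.
  have /PFE := PFxs => xsF.
  by have := mmin s Ss; lia.
have mt : m = (F - q).+1.
  apply/eqP; rewrite eqn_leq; apply/andP; split; last by lia.
  rewrite leqNgt; apply/negP => tm.
  (* This excludes q = 0, where [q.-1] would truncate to q itself. *)
  have mF : m <= F.+1 by apply: mmin => //; apply: big.
  have Sq1 : S q.-1 by apply: tail; lia.
  have PFF1 : pseudo_frobenius S F.-1 by apply/PFE; lia.
  (* The pairs (F, q) and (F-1, q-1) have the same difference. *)
  by have := diffI F q F.-1 q.-1 FPF PFF1 Sq Sq1 qF; lia.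
set n := size (sporadic_seq S) in E.
have Fnm : F.+1 = n * m.
  (* F + 1 = n + g = n + tn = n(t + 1). *)
  have := size_sporadic_genus hS; rewrite -E typeE -/F -/n mt => <-.
  by rewrite mulnS mulnC.
have [u sub] : uniq (mkseq (muln^~ m) n) /\
    {subset mkseq (muln^~ m) n <= sporadic_seq S}.
  apply: mkseq_muln_sporadic => // k _.
  by elim: k => // k IHk; rewrite mulSn; apply: add.
exists m, n; split=> //; first by case: (n) Fnm.
have [|_ NE] := uniq_min_size u sub; first by rewrite size_mkseq.
apply/seteqP; split=> x.
  move=> Sx; have [le|gt] := leqP (n * m) x; first by right.
  have : x \in sporadic_seq S.
    by apply/mem_sporadic_seq; split=> //; rewrite -ltnS -/F Fnm.
  by rewrite -NE => /mapP[k]; rewrite mem_iota /= => kn ->; left; exists k.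
case=> [[k kn <-]|/=]; last by rewrite -Fnm; apply: big.
have : k * m \in sporadic_seq S; last by case/mem_sporadic_seq.
by rewrite -NE; apply/mapP; exists k => //; rewrite mem_iota.
Qed.

(** * From the rational quotient to a product of naturals *)

(** The denominator counts the sporadic elements, among them 0, so it is nonzero and can be
    cleared. *)
Lemma type_eq_ratio S : numerical_semigroup S ->
  (((sg_type S)%:R : rat)
    = (genus S)%:R / ((frobenius S)%:R + 1 - (genus S)%:R))%R
  <-> sg_type S * size (sporadic_seq S) = genus S.
Proof.
move=> hS; have n0 : ((size (sporadic_seq S))%:R != 0 :> rat)%R.
  rewrite pnatr_eq0 size_eq0; apply/eqP => N0.
  have /mem_sporadic_seq : S 0 /\ 0 <= frobenius S by case: hS.
  by rewrite N0.
rewrite natr1 -(size_sporadic_genus hS) natrD addrK.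
split=> [/(congr1 ( *%R^~ (size (sporadic_seq S))%:R))%R|<-].
  by rewrite divfK // -natrM => /eqP; rewrite eqr_nat => /eqP.
by rewrite natrM mulfK.
Qed.

Unset Implicit Arguments.
Set Strict Implicit.
Local Open Scope ring_scope.

Theorem theorem1p6 (S : set nat) (hS : numerical_semigroup S)
    (hSN : S <> [set: nat]) :
  ((sg_type S)%:R : rat)
    = (genus S)%:R / ((frobenius S)%:R + 1 - (genus S)%:R)
  <->
  (symmetric_sg S \/
   exists m n : nat, [/\ (0 < m)%N, (0 < n)%N &
     S = [set (k * m)%N | k in [set k : nat | (k < n)%N]]
         `|` [set x : nat | (n * m <= x)%N]]).
Proof.
rewrite type_eq_ratio //; split=> [E|[sym|[m [n [m0 n0 SE]]]]].
- have [t1|t1] := pselect (sg_type S = 1%N).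
    by left; apply: symmetric_of_type1.
  by right; apply: multiples_of_type_genus.
- exact: type_genus_of_symmetric.
- by move: hS hSN; rewrite SE => hS hSN; apply: type_genus_of_multiples.
Qed.
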